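(* Let $d \geq 2$ and $\rho \in (0,1)$, and let $0 < a_\rho < b_\rho < 1$ and $\varepsilon_\rho \in (0,1)$ be constants having property (P) described in the context. Then for every $s \in (d - \varepsilon_\rho, d]$ there exists an infinite collection $\mathscr E$ of self-similar Cantor sets in $[0,1]^d$ with the following properties. Every $E^\ast \in \mathscr E$ has Hausdorff dimension at most $s$ and satisfies $$\Delta(E^\ast) \not\supseteq [0,a) \quad \text{for any } a > 0,$$ but there exists a finite union $K^\ast$ of affine copies of $E^\ast$ such that $$\Delta(K^\ast) \supseteq [0, b_\rho].$$
   Context: $\Delta(E) = \{|x-y| : x,y\in E\}$ is the distance set ($|\cdot|$ Euclidean norm). $\ell(Q)$ is the side-length of a cube $Q$; dyadic cubes are closed. $\mathbb H^s$ is $s$-dimensional Hausdorff measure; the $s$-dimensional dyadic Hausdorff content is $\mathcal H^s_\infty(E) = \inf\{\sum_i \ell(Q_i)^s : E \subseteq \bigcup_{i=1}^\infty Q_i,\ Q_i \text{ closed dyadic cubes}\}$, $s\in(0,d]$. Property (P) (for given $d,\rho$): the constants $a_\rho,b_\rho,\varepsilon_\rho$ depend only on $d$ and $\rho$, and for every Borel set $E\subseteq[0,1]^d$ with $\mathbb H^s(E)>0$ for some $s>d-\varepsilon_\rho$, one has $\Delta(E)\supseteq\bigcup\{\ell(Q)[a_\rho,b_\rho] : Q\in\mathcal D_\rho(E;s)\}$, where $\mathcal D_\rho(E;s)$ is the collection of dyadic cubes $Q\subseteq[0,1]^d$ with $\mathcal H^s_\infty(E\cap Q)>(1-\rho)\ell(Q)^s$.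 (Such constants exist for all sufficiently small $\rho$.) An affine copy of a set $E^\ast$ means a set $x + uE^\ast$ with $x\in\mathbb R^d$, $u>0$. *)

(* Defs.v *)
From HB Require Import structures.
From mathcomp Require Import all_boot all_order all_algebra.
From mathcomp Require Import all_classical all_reals all_analysis.

Set Implicit Arguments.
Unset Strict Implicit.
Unset Printing Implicit Defensive.

Import Order.TTheory GRing.Theory Num.Theory.
Import numFieldNormedType.Exports.

Local Open Scope classical_set_scope.
Local Open Scope ring_scope.

(* R^d is 'rV[R]_d. The library norm on matrices is the sup norm, so the
   Euclidean norm is introduced separately; the two induce the same topology,
   so open, closed, compact, connected sets are those of the library. *)
Definition enorm (R : realType) (d : nat) (x : 'rV[R]_d) : R :=
  Num.sqrt (\sum_(i < d) x 0 i ^+ 2).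

Definition unit_cube (R : realType) (d : nat) : set 'rV[R]_d :=
  [set x | forall i, 0 <= x 0 i <= 1].

Arguments unit_cube : clear implicits.

Definition distance_set (R : realType) (d : nat) (E : set 'rV[R]_d) : set R :=
  [set enorm (x - y) | x in E & y in E].

Definition borel (R : realType) (d : nat) : set (set 'rV[R]_d) :=
  <<s [set A | open A] >>.

(* Equal to -oo on the empty set. *)
Definition diam (R : realType) (d : nat) (U : set 'rV[R]_d) : \bar R :=
  ereal_sup [set (enorm (x - y))%:E | x in U & y in U].

(* diam(U)^s, with the empty set contributing 0 for every s and a singleton
   contributing 0^0 = 1 when s = 0, so that H^0 is the counting measure. *)
Definition diam_pow (R : realType) (d : nat) (s : R) (U : set 'rV[R]_d)
    : \bar R :=
  if U == set0 then 0%E else poweR (diam U) s.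

Definition hausdorff_premeasure (R : realType) (d : nat) (s delta : R)
    (E : set 'rV[R]_d) : \bar R :=
  ereal_inf [set (\sum_(0 <= i <oo) diam_pow s (U i))%E
            | U in [set U : (set 'rV[R]_d)^nat |
                E `<=` \bigcup_i U i /\ forall i, (diam (U i) <= delta%:E)%E]].

Definition hausdorff_measure (R : realType) (d : nat) (s : R)
    (E : set 'rV[R]_d) : \bar R :=
  ereal_sup [set hausdorff_premeasure s delta E
            | delta in [set delta : R | 0 < delta]].

Definition hausdorff_dim (R : realType) (d : nat) (E : set 'rV[R]_d)
    : \bar R :=
  ereal_inf [set s%:E
            | s in [set s : R | 0 <= s /\ hausdorff_measure s E = 0%E]].

(* A closed dyadic cube is represented by its code (k, n), with k in Z and
   n in Z^d: it is the product of the [n_i 2^-k, (n_i + 1) 2^-k]. *)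
Definition dyadic_code (d : nat) : Type := (int * 'rV[int]_d)%type.

Definition dyadic_side (R : realType) (d : nat) (q : dyadic_code d) : R :=
  2 ^ (- q.1).

Arguments dyadic_side R {d} q.

Definition dyadic_cube (R : realType) (d : nat) (q : dyadic_code d)
    : set 'rV[R]_d :=
  [set x | forall i, (q.2 0 i)%:~R * dyadic_side R q <= x 0 i
                     <= (q.2 0 i + 1)%:~R * dyadic_side R q].

Arguments dyadic_cube R {d} q.

Definition dyadic_content (R : realType) (d : nat) (s : R)
    (E : set 'rV[R]_d) : \bar R :=
  ereal_inf [set (\sum_(0 <= i <oo) (dyadic_side R (Q i) `^ s)%:E)%E
            | Q in [set Q : (dyadic_code d)^nat |
                E `<=` \bigcup_i dyadic_cube R (Q i)]].

Definition dense_dyadic (R : realType) (d : nat) (rho s : R)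
    (E : set 'rV[R]_d) : set (dyadic_code d) :=
  [set q | dyadic_cube R q `<=` unit_cube R d /\
    (((1 - rho) * dyadic_side R q `^ s)%:E
       < dyadic_content s (E `&` dyadic_cube R q))%E].

Definition property_P (R : realType) (d : nat) (rho a b eps : R) : Prop :=
  forall (E : set 'rV[R]_d) (s : R),
    borel E -> E `<=` unit_cube R d ->
    d%:R - eps < s -> (0 < hausdorff_measure s E)%E ->
    \bigcup_(q in dense_dyadic rho s E)
        [set dyadic_side R q * t | t in `[a, b]]
      `<=` distance_set E.

Arguments property_P {R} d rho a b eps.

Definition contracting_similarity (R : realType) (d : nat)
    (f : 'rV[R]_d -> 'rV[R]_d) : Prop :=
  exists r : R, 0 < r < 1 /\
    forall x y, enorm (f x - f y) = r * enorm (x - y).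

(* The attractor of a finite family of contracting similarities. *)
Definition self_similar (R : realType) (d : nat) (E : set 'rV[R]_d) : Prop :=
  [/\ E !=set0, compact E &
      exists (m : nat) (f : 'I_m -> 'rV[R]_d -> 'rV[R]_d),
        (forall i, contracting_similarity (f i)) /\
        E = \bigcup_i (f i @` E)].

(* By Brouwer's theorem these conditions say that E is homeomorphic to the ternary
   Cantor set. *)
Definition cantor_set (R : realType) (d : nat) (E : set 'rV[R]_d) : Prop :=
  [/\ E !=set0, compact E, perfect_set E & totally_disconnected E].

Definition affine_copy (R : realType) (d : nat) (x : 'rV[R]_d) (u : R)
    (E : set 'rV[R]_d) : set 'rV[R]_d :=
  [set x + u *: y | y in E].

Definition finite_union_affine_copies (R : realType) (d : nat)
    (E K : set 'rV[R]_d) : Prop :=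
  exists (n : nat) (x : 'I_n -> 'rV[R]_d) (u : 'I_n -> R),
    (forall i, 0 < u i) /\ K = \bigcup_i affine_copy (x i) (u i) E.

(* Main.v *)
Require Import Defs.
From mathcomp Require Import all_boot all_order all_algebra.
From mathcomp Require Import all_classical all_reals all_analysis.
From mathcomp Require Import zify ring lra.

Import Order.TTheory GRing.Theory Num.Theory.
Import numFieldNormedType.Exports.

Local Open Scope classical_set_scope.
Local Open Scope ring_scope.

(** The collection consists of the products E = C^d, where n > d and C is the
    set of reals whose base-n^2 expansion uses only the digits 0, ..., n-1.
    Three estimates on its digits give the required properties.

    Size. E is the union of n^d copies of itself contracted by n^-2, so it has
    dimension at most d/2; since eps < 1 and d >= 2, s > d - 1 >= d/2
    ([dust_hausdorff_measure0]).

    Missing distances. C spans [0, 1/(n+1)], so two points of the same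
    first-generation cell are at distance at most (d/(n+1)) n^-2, whereas points
    of different cells are at distance at least (n/(n+1)) n^-2. As d < n, there
    is an interval of distances that do not occur in E, and by self-similarity
    it recurs at every scale n^-2k ([dust_gap]), so that no [0, a) is contained
    in the distance set. This also makes E totally disconnected, because a
    connected subset with two points realizes an interval of distances starting
    at 0 ([totally_disconnected_of_missing_distances]).

    Recovering distances. Every integer of [0, n^2) is uniquely n q + r with
    0 <= q, r < n, so n C + C is a full interval; as C is symmetric about its
    midpoint, n C - C is the interval [-1/(n+1), n/(n+1)]
    ([digit_cantor_dilate_diff]). Along one coordinate axis the differences of
    2 n E and 2 E therefore have all lengths in [0, 1), and the union of these
    two dilates of E serves as K ([dust_union_distances]).

    Different n give different sets, since (1/(n+1), ..., 1/(n+1)) is the top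
    corner of E. *)

(** * A Cantor set on the line defined by its digits *)

(** For n > 1, the set of sums of a_i n^-2i over i >= 1 with digits a_i < n, encoded
    coinductively: it is the largest subset of [0, 1/(n+1)] each of whose points
    admits a first digit that leaves a remainder in the set. Then membership of
    a point, closedness and self-similarity are each proved by exhibiting one
    set stable under removal of a digit, without handling series. *)
Definition digit_cantor (R : realType) (n : nat) : set R :=
  \bigcup_(X in [set X : set R | X `<=` `[0, n.+1%:R^-1] /\
     forall x, X x -> exists2 a : nat, (a < n)%N & X (n%:R ^+ 2 * x - a%:R)]) X.

Lemma digit_cantor_coind (R : realType) (n : nat) (X : set R) :
  (forall x, X x -> 0 <= x <= n.+1%:R^-1) ->
  (forall x, X x -> exists2 a : nat, (a < n)%N & X (n%:R ^+ 2 * x - a%:R)) ->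
  X `<=` digit_cantor R n.
Proof.
move=> Xb Xs x Xx; exists X => //; split => // y /Xb.
Qed.

Lemma digit_cantor_bounds (R : realType) (n : nat) (x : R) :
  digit_cantor R n x -> 0 <= x <= n.+1%:R^-1.
Proof. by move=> [X [+ _] Xx] => /(_ _ Xx); rewrite /= in_itv. Qed.

Lemma digit_cantor_unfold (R : realType) (n : nat) (x : R) :
  digit_cantor R n x ->
  exists2 a : nat, (a < n)%N & digit_cantor R n (n%:R ^+ 2 * x - a%:R).
Proof.
move=> [X [Xb Xs] Xx]; have [a an Xa] := Xs _ Xx.
by exists a => //; exists X.
Qed.

(** The interval [0, 1/(n+1)] is mapped into itself by x |-> (x + a) / n^2
    because 1/(n+1) + (n-1) = n^2/(n+1); so adding one point of this form keeps
    the set admissible in the coinductive definition. *)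
Lemma digit_cantor_fold (R : realType) (n a : nat) (x : R) : (a < n)%N ->
  digit_cantor R n x -> digit_cantor R n ((x + a%:R) / n%:R ^+ 2).
Proof.
move=> an Cx; have n0 : (0 : R) < n%:R by rewrite ltr0n; case: n an {Cx}.
have n10 : (0 : R) < n.+1%:R by rewrite ltr0n.
have N0 : (0 : R) < n%:R ^+ 2 by rewrite exprn_gt0.
pose X := digit_cantor R n `|` [set (x + a%:R) / n%:R ^+ 2].
apply: (@digit_cantor_coind _ _ X); last by right.
- move=> y [/digit_cantor_bounds //|->].
  have /andP[x0 x1] := digit_cantor_bounds _ _ _ Cx.
  apply/andP; split; first by apply: divr_ge0; [exact: addr_ge0|exact: ltW].
  rewrite ler_pdivrMr//.
  have an1 : a%:R <= n%:R - 1 :> R by rewrite lerBrDr natr1 ler_nat.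
  apply: (le_trans (lerD x1 an1)); rewrite -natr1 in n10 *.
  suff -> : (n%:R + 1)^-1 * n%:R ^+ 2 = (n%:R + 1)^-1 + (n%:R - 1) :> R by [].
  by field; rewrite lt0r_neq0.
- move=> y [/digit_cantor_unfold[b bn Cb]|->]; first by exists b => //; left.
  exists a => //; left; suff -> : n%:R ^+ 2 * ((x + a%:R) / n%:R ^+ 2) - a%:R = x by [].
  by field; rewrite lt0r_neq0.
Qed.

Lemma digit_cantor0 (R : realType) (n : nat) : (0 < n)%N -> digit_cantor R n 0.
Proof.
move=> n0; apply: (@digit_cantor_coind _ _ [set 0]) => //.
  by move=> _ ->; rewrite lexx invr_ge0 ler0n.
by move=> _ ->; exists 0%N => //=; rewrite mulr0 subr0.
Qed.

(** The expansion all of whose digits are n-1. *)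
Lemma digit_cantor_max (R : realType) (n : nat) : (0 < n)%N ->
  digit_cantor R n n.+1%:R^-1.
Proof.
move=> n0; apply: (@digit_cantor_coind _ _ [set n.+1%:R^-1]) => //.
  by move=> _ ->; rewrite lexx invr_ge0 ler0n.
move=> _ ->; exists n.-1; first by rewrite prednK.
rewrite /= -subn1 natrB// -natr1; field.
by rewrite natr1 pnatr_eq0.
Qed.

(** The closure is again stable under removal of a digit, since a finite union
    of closed sets is closed, and is thus contained in the largest such set. *)
Lemma digit_cantor_closed (R : realType) (n : nat) : closed (digit_cantor R n).
Proof.
apply/closure_id/seteqP; split; first exact: subset_closure.
apply: digit_cantor_coind.
- move=> x Cx; suff : `[0, n.+1%:R^-1]%classic x by rewrite /= in_itv.
  have : closed `[(0 : R), n.+1%:R^-1]%classic by exact: itv_closed.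
  move=> /closure_id ->.
  by apply: closureS Cx => y /digit_cantor_bounds; rewrite /= in_itv.
- pose F (a : nat) := (fun x : R => n%:R ^+ 2 * x - a%:R) @^-1` closure (digit_cantor R n).
  have cF : closed (\bigcup_(a in `I_n) F a).
    apply: closed_bigcup => // a _; apply: preimage_closed; last exact: closed_closure.
    by move=> x _; apply: cvgB; [apply: cvgM; [exact: cvg_cst|exact: cvg_id]|exact: cvg_cst].
  move=> x Cx; suff : (\bigcup_(a in `I_n) F a) x by move=> [a an Fa]; exists a.
  move/closure_id: cF => ->; apply: closureS Cx => y /digit_cantor_unfold[a an Ca].
  by exists a => //; exact: subset_closure.
Qed.

Lemma digit_cantor_compact (R : realType) (n : nat) : compact (digit_cantor R n).
Proof.
apply: subclosed_compact (@segment_compact R 0 n.+1%:R^-1) _.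
  exact: digit_cantor_closed.
by move=> y /digit_cantor_bounds; rewrite /= in_itv.
Qed.

(** At scale 1 a point differs from 0 or from 1/(n+1); self-similarity carries
    the two choices to every smaller scale. *)
Lemma digit_cantor_dense_in_itself (R : realType) (n : nat) (k : nat) (x : R) :
  (0 < n)%N -> digit_cantor R n x ->
  exists y, [/\ digit_cantor R n y, y != x & `|x - y| <= (n%:R ^+ 2) ^- k].
Proof.
move=> n0; have nR0 : (0 : R) < n%:R by rewrite ltr0n.
have N0 : (0 : R) < n%:R ^+ 2 by rewrite exprn_gt0.
elim: k x => [|k IH] x Cx.
  have ne : n.+1%:R^-1 != 0 :> R by rewrite invr_eq0 pnatr_eq0.
  have [y Cy yx] : exists2 y, digit_cantor R n y & y != x.
    have [x0|x0] := eqVneq x 0.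
      by exists n.+1%:R^-1; [exact: digit_cantor_max|rewrite x0].
    by exists 0; [exact: digit_cantor0|rewrite eq_sym].
  exists y; split => //; rewrite expr0 invr1.
  have i1 : n.+1%:R^-1 <= 1 :> R by rewrite invf_le1 ?ler1n ?ltr0n.
  have /andP[x0 x1] := digit_cantor_bounds _ _ _ Cx.
  have /andP[y0 y1] := digit_cantor_bounds _ _ _ Cy.
  have {}x1 := le_trans x1 i1; have {}y1 := le_trans y1 i1.
  by rewrite ler_norml; apply/andP; split; lra.
have [a an Ca] := digit_cantor_unfold _ _ _ Cx.
have [y [Cy yx xy]] := IH _ Ca.
exists ((y + a%:R) / n%:R ^+ 2); split; first exact: digit_cantor_fold.
  by apply: contra yx => /eqP <-; apply/eqP; field; rewrite lt0r_neq0.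
have -> : x - (y + a%:R) / n%:R ^+ 2 =
    (n%:R ^+ 2 * x - a%:R - y) / n%:R ^+ 2 by field; rewrite lt0r_neq0.
by rewrite normrM normfV (gtr0_norm N0) [_ ^+ k.+1]exprSr [(_ ^+ k * _)^-1]invfM
  ler_pM2r ?invr_gt0.
Qed.

(** The first k digits of the interval property of n C + C, written with
    1/(n+1) - c' in place of the second point because C is symmetric under
    x |-> 1/(n+1) - x. If m = n q + r is the first base-n^2 digit of t, then q
    is the first digit of c and n - 1 - r is that of c'. *)
Lemma digit_cantor_approx (R : realType) (n k : nat) (t : R) : (0 < n)%N ->
  0 <= t < 1 -> exists c c', [/\ digit_cantor R n c, digit_cantor R n c' &
    `|t - (n%:R * c - c' + n.+1%:R^-1)| <= 2 * (n%:R ^+ 2) ^- k].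
Proof.
move=> n0; have nR0 : (0 : R) < n%:R by rewrite ltr0n.
have N0 : (0 : R) < n%:R ^+ 2 by rewrite exprn_gt0.
elim: k t => [|k IH] t /andP[t0 t1].
  exists 0, 0; split; [exact: digit_cantor0|exact: digit_cantor0|].
  have i1 : n.+1%:R^-1 <= 1 :> R by rewrite invf_le1 ?ler1n ?ltr0n.
  have i0 : 0 <= n.+1%:R^-1 :> R by rewrite invr_ge0.
  move: n.+1%:R^-1 i1 i0 => i i1 i0.
  by rewrite mulr0 expr0 invr1 ler_norml; apply/andP; split; lra.
have s0 : 0 <= n%:R ^+ 2 * t by rewrite mulr_ge0 // ltW.
pose m := Num.truncn (n%:R ^+ 2 * t).
have /andP[m1 m2] : m%:R <= n%:R ^+ 2 * t < m.+1%:R by exact: truncn_itv.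
have mN : (m < n * n)%N.
  rewrite -(ltr_nat R) natrM -expr2; apply: (le_lt_trans m1).
  by rewrite -[ltRHS]mulr1 ltr_pM2l.
have qn : (m %/ n < n)%N by rewrite ltn_divLR.
have rn : (m %% n < n)%N by rewrite ltn_mod.
have [|c [c' [Cc Cc' cc]]] := IH (n%:R ^+ 2 * t - m%:R).
  by rewrite subr_ge0 m1 /= ltrBlDl natr1.
exists ((c + (m %/ n)%:R) / n%:R ^+ 2), ((c' + (n.-1 - m %% n)%:R) / n%:R ^+ 2).
split; [exact: digit_cantor_fold|apply: digit_cantor_fold => //; lia|].
have mE : m%:R = (m %/ n)%:R * n%:R + (m %% n)%:R :> R.
  by rewrite {1}(divn_eq m n) natrD natrM.
have -> : (n.-1 - m %% n)%:R = n%:R - 1 - (m %% n)%:R :> R.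
  rewrite natrB; last lia.
  by rewrite -subn1 natrB.
rewrite mE in cc.
set q := (m %/ n)%:R in cc *; set r := (m %% n)%:R in cc *.
have -> : t - (n%:R * ((c + q) / n%:R ^+ 2) - (c' + (n%:R - 1 - r)) / n%:R ^+ 2
      + n.+1%:R^-1) =
    (n%:R ^+ 2 * t - (q * n%:R + r) - (n%:R * c - c' + n.+1%:R^-1)) / n%:R ^+ 2.
  rewrite -natr1; field.
  by rewrite natr1 !pnatr_eq0 -lt0n n0.
by rewrite normrM normfV (gtr0_norm N0) [_ ^+ k.+1]exprSr [(_ ^+ k * _)^-1]invfM
  mulrA ler_pM2r ?invr_gt0.
Qed.

Lemma inv_sqr_itv (R : realType) (n : nat) : (1 < n)%N ->
  0 < n%:R ^+ 2 :> R /\ 0 <= (n%:R ^+ 2 : R)^-1 < 1.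
Proof.
move=> n1; have N1 : 1 < n%:R ^+ 2 :> R.
  by rewrite -natrX ltr1n -(exp1n 2) ltn_exp2r.
have N0 : 0 < n%:R ^+ 2 :> R by exact: lt_trans N1.
by split=> //; apply/andP; split; [rewrite invr_ge0 ltW|rewrite invf_lt1].
Qed.

Lemma geometric_small (R : realType) (c z e : R) :
  0 <= z < 1 -> 0 < e -> exists k, c * z ^+ k < e.
Proof.
move=> /andP[z0 z1] e0; have := @cvg_geometric R c z.
rewrite ger0_norm// => /(_ z1) /cvgr_lt /(_ _ e0) [k _ kP].
by exists k; exact: (kP k (leqnn k)).
Qed.

(** The set n C - C is compact, so the approximations of the previous lemma
    give actual elements. *)
Lemma digit_cantor_dilate_diff (R : realType) (n : nat) (t : R) : (1 < n)%N ->
  0 <= t < n%:R / n.+1%:R ->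
  exists c c', [/\ digit_cantor R n c, digit_cantor R n c' & t = n%:R * c - c'].
Proof.
move=> n1 /andP[t0 t1]; have n0 := ltnW n1.
pose D := (fun p : R * R => n%:R * p.1 - p.2) @` (digit_cantor R n `*` digit_cantor R n).
have cD : compact D.
  apply: continuous_compact.
    apply: continuous_subspaceT => p; apply: cvgB; last exact: cvg_snd.
    by apply: cvgM; [exact: cvg_cst|exact: cvg_fst].
  by apply: compact_setX; exact: digit_cantor_compact.
suff : D t by move=> [[c c'] [/= Cc Cc'] <-]; exists c, c'.
have := compact_closed (@Rhausdorff R) cD => /closure_id ->.
move=> U /nbhs_ballP[e /= e0 eU].
have [N0 zP] := inv_sqr_itv R n n1.
have [k kP] := geometric_small R 2 _ e zP e0.
have [|c [c' [Cc Cc' cc]]] := digit_cantor_approx R n k (t + n.+1%:R^-1) n0.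
  rewrite addr_ge0 ?invr_ge0 ?ler0n//=.
  suff h : n%:R / n.+1%:R + n.+1%:R^-1 = 1 :> R by rewrite -[ltRHS]h ltrD2r.
  by rewrite -natr1; field; rewrite natr1 pnatr_eq0.
exists (n%:R * c - c'); split; first by exists (c, c').
apply: eU; rewrite /ball /=; rewrite exprVn in kP.
apply: le_lt_trans kP; apply: le_trans cc; rewrite le_eqVlt; apply/orP; left.
by apply/eqP; congr `|_|; ring.
Qed.

(** * The Euclidean norm *)

Lemma enorm_ge0 (R : realType) (d : nat) (x : 'rV[R]_d) : 0 <= enorm x.
Proof. exact: sqrtr_ge0. Qed.

Lemma enorm0 (R : realType) (d : nat) : enorm (0 : 'rV[R]_d) = 0.
Proof. by rewrite /enorm big1 ?sqrtr0// => i _; rewrite mxE expr0n. Qed.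

Lemma enormZ (R : realType) (d : nat) (c : R) (x : 'rV[R]_d) :
  enorm (c *: x) = `|c| * enorm x.
Proof.
rewrite /enorm -sqrtr_sqr -sqrtrM ?sqr_ge0// mulr_sumr.
by congr Num.sqrt; apply: eq_bigr => i _; rewrite mxE exprMn.
Qed.

Lemma coord_le_enorm (R : realType) (d : nat) (x : 'rV[R]_d) (i : 'I_d) :
  `|x 0 i| <= enorm x.
Proof.
rewrite -sqrtr_sqr ler_wsqrtr// (bigD1 i)//= lerDl.
by apply: sumr_ge0 => j _; exact: sqr_ge0.
Qed.

(** The factor d instead of its square root keeps the later estimates free of
    radicals, at the price of asking for n > d. *)
Lemma enorm_le (R : realType) (d : nat) (M : R) (x : 'rV[R]_d) :
  0 <= M -> (forall i, `|x 0 i| <= M) -> enorm x <= d%:R * M.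
Proof.
move=> M0 xM; have dM0 : 0 <= d%:R * M by exact: mulr_ge0.
rewrite -[leRHS]ger0_norm// -sqrtr_sqr ler_wsqrtr//.
apply: (@le_trans _ _ (\sum_(i < d) M ^+ 2)).
  by apply: ler_sum => i _; rewrite -real_normK ?num_real// lerXn2r// nnegrE.
rewrite sumr_const card_ord -[leLHS]mulr_natl exprMn ler_wpM2r ?sqr_ge0//.
by rewrite -natrX ler_nat; case: d {x xM dM0} => // d; rewrite expnS expn1 leq_pmulr.
Qed.

Lemma enorm_continuous (R : realType) (d : nat) :
  continuous (@enorm R d).
Proof.
have cs : continuous (fun x : 'rV[R]_d => \sum_(i < d) x 0 i ^+ 2).
  apply: continuous_big; first exact: add_continuous.
  move=> i _ x.
  apply: (@continuous_comp _ _ _ (fun x : 'rV[R]_d => x 0 i) (fun u => u ^+ 2)).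
    exact: coord_continuous.
  exact: exprn_continuous.
move=> x; apply: (@continuous_comp _ _ _ _ Num.sqrt); first exact: cs.
exact: sqrt_continuous.
Qed.

Lemma enorm_delta (R : realType) (d : nat) (i : 'I_d) (c : R) :
  enorm (c *: delta_mx 0 i : 'rV[R]_d) = `|c|.
Proof.
rewrite enormZ /enorm (bigD1 i)//= big1 ?addr0 => [|j ji].
  by rewrite !mxE !eqxx expr1n sqrtr1 mulr1.
by rewrite !mxE eqxx (negbTE ji) expr0n.
Qed.

(** The distance to x is continuous, so on the component of x it takes every
    value between 0 and its value at any other point. *)
Lemma totally_disconnected_of_missing_distances (R : realType) (d : nat)
    (E : set 'rV[R]_d) :
  (forall a : R, 0 < a -> ~ (`[0, a[ `<=` distance_set E)) ->
  totally_disconnected E.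
Proof.
move=> miss x Ex; apply/seteqP; split => [y yE|_ ->]; last first.
  exact: connected_component_refl.
apply: contrapT => /eqP yx.
pose g (z : 'rV[R]_d) := enorm (z - x).
have cg : connected (g @` connected_component E x).
  apply: connected_continuous_connected; first exact: component_connected.
  apply: continuous_subspaceT => z.
  apply: (@continuous_comp _ _ _ (fun z : 'rV[R]_d => z - x) (@enorm R d));
    last exact: enorm_continuous.
  exact: (cvgB cvg_id (cvg_cst x)).
have gy : 0 < g y.
  rewrite lt_def enorm_ge0 andbT; apply: contra yx => /eqP g0.
  rewrite -subr_eq0; apply/eqP/rowP => i; rewrite [RHS]mxE.
  apply/eqP; rewrite -normr_le0 -g0; exact: coord_le_enorm.
apply: (miss _ gy) => t /=; rewrite in_itv/= => /andP[t0 ty].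
have : (g @` connected_component E x) t.
  have ci := (connected_intervalP _).1 cg.
  apply: (ci 0 (g y)) => //; last by rewrite t0 ltW.
    by exists x; [exact: connected_component_refl|rewrite /g subrr enorm0].
move=> [z zE <-]; exists z; first exact: connected_component_sub zE.
by exists x.
Qed.

(** * The product set, its cells and its distances *)

Definition cantor_dust (R : realType) (d n : nat) : set 'rV[R]_d :=
  [set x | forall i, digit_cantor R n (x 0 i)].

Definition dust_map (R : realType) (d n : nat) (a : {ffun 'I_d -> 'I_n})
    (x : 'rV[R]_d) : 'rV[R]_d :=
  (n%:R ^+ 2)^-1 *: (x + \row_i (a i)%:R).

Lemma dust_fold (R : realType) (d n : nat) (a : {ffun 'I_d -> 'I_n}) x :
  cantor_dust R d n x -> cantor_dust R d n (dust_map R d n a x).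
Proof. by move=> Ex i; rewrite !mxE mulrC; exact: digit_cantor_fold. Qed.

Lemma dust_unfold (R : realType) (d n : nat) (x : 'rV[R]_d) : (0 < n)%N ->
  cantor_dust R d n x ->
  exists a y, cantor_dust R d n y /\ x = dust_map R d n a y.
Proof.
move=> n0 Ex.
have /choice[a aP] : forall i, exists a : 'I_n,
    digit_cantor R n (n%:R ^+ 2 * x 0 i - a%:R).
  by move=> i; have [a an Ca] := digit_cantor_unfold _ _ _ (Ex i); exists (Ordinal an).
exists [ffun i => a i], (\row_i (n%:R ^+ 2 * x 0 i - (a i)%:R)); split.
  by move=> i; rewrite mxE; exact: aP.
apply/rowP => i; rewrite !mxE ffunE subrK mulrA mulVf ?mul1r//.
by rewrite expf_neq0// pnatr_eq0 -lt0n.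
Qed.

Lemma enorm_dust_map (R : realType) (d n : nat) (a : {ffun 'I_d -> 'I_n})
    (x y : 'rV[R]_d) :
  enorm (dust_map R d n a x - dust_map R d n a y) = (n%:R ^+ 2)^-1 * enorm (x - y).
Proof.
by rewrite /dust_map -scalerBr opprD addrACA subrr addr0 enormZ ger0_norm//.
Qed.

Lemma dust_self_similar (R : realType) (d n : nat) : (1 < n)%N ->
  self_similar (cantor_dust R d n).
Proof.
move=> n1; have n0 := ltnW n1; split.
- by exists 0 => i; rewrite mxE; exact: digit_cantor0.
- by apply: (@rV_compact _ _ (fun=> digit_cantor R n)) => i; exact: digit_cantor_compact.
- exists #|{ffun 'I_d -> 'I_n}|, (fun i => dust_map R d n (enum_val i)); split.
    move=> i; exists (n%:R ^+ 2)^-1; split; last by move=> x y; exact: enorm_dust_map.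
    have [N0 /andP[_ z1]] := inv_sqr_itv R n n1.
    by rewrite invr_gt0 N0 z1.
  apply/seteqP; split => [x Ex|x [i _ [y Ey <-]]]; last exact: dust_fold.
  have [a [y [Ey ->]]] := dust_unfold _ _ _ _ n0 Ex.
  by exists (enum_rank a) => //; exists y => //; rewrite enum_rankK.
Qed.

Lemma dust_enorm_le (R : realType) (d n : nat) (x y : 'rV[R]_d) :
  cantor_dust R d n x -> cantor_dust R d n y ->
  enorm (x - y) <= d%:R / n.+1%:R.
Proof.
move=> Ex Ey; apply: enorm_le => // i; rewrite !mxE.
have /andP[x0 x1] := digit_cantor_bounds _ _ _ (Ex i).
have /andP[y0 y1] := digit_cantor_bounds _ _ _ (Ey i).
by rewrite ler_norml; apply/andP; split; move: x1 y1; move: n.+1%:R^-1 => w; lra.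
Qed.

(** In a coordinate where the digits differ, the digits contribute at least 1
    and the remainders at most 1/(n+1), before the contraction by n^-2. *)
Lemma dust_separation (R : realType) (d n : nat) (a b : {ffun 'I_d -> 'I_n})
    (x y : 'rV[R]_d) : a != b ->
  cantor_dust R d n x -> cantor_dust R d n y ->
  n%:R / n.+1%:R / n%:R ^+ 2 <= enorm (dust_map R d n a x - dust_map R d n b y).
Proof.
move=> ab Ex Ey.
have [i abi] : exists i, a i != b i.
  apply/existsP; apply: contraNT ab => /existsPn ab.
  by apply/eqP/ffunP => i; apply/eqP; move: (ab i); rewrite negbK.
apply: le_trans (coord_le_enorm _ _ _ i); rewrite !mxE.
have n0 : (0 : R) < n%:R by rewrite ltr0n (leq_ltn_trans _ (ltn_ord (a i))).
have N0 : (0 : R) < n%:R ^+ 2 by rewrite exprn_gt0.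
have -> : (n%:R ^+ 2)^-1 * (x 0 i + (a i)%:R) - (n%:R ^+ 2)^-1 * (y 0 i + (b i)%:R)
   = (x 0 i - y 0 i + ((a i)%:R - (b i)%:R)) / n%:R ^+ 2 :> R.
  by field; rewrite lt0r_neq0.
rewrite normrM normfV (gtr0_norm N0) ler_pM2r ?invr_gt0//.
have /andP[x0 x1] := digit_cantor_bounds _ _ _ (Ex i).
have /andP[y0 y1] := digit_cantor_bounds _ _ _ (Ey i).
have -> : n%:R / n.+1%:R = 1 - n.+1%:R^-1 :> R.
  by rewrite -natr1; field; rewrite natr1 pnatr_eq0.
move: n.+1%:R^-1 x1 y1 => w x1 y1; rewrite ler_normr.
have : (a i < b i)%N || (b i < a i)%N by rewrite -neq_ltn.
by move=> /orP[]; rewrite -(ler_nat R) -natr1 => ab1; apply/orP; [right|left]; lra.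
Qed.

(** Two points in the same cell have n^-2 times the distance of two points of
    the set, so they obey the previous scale; two points in different cells are
    already too far apart. *)
Lemma dust_gap (R : realType) (d n k : nat) (x y : 'rV[R]_d) : (0 < n)%N ->
  cantor_dust R d n x -> cantor_dust R d n y ->
  ~ (d%:R < enorm (x - y) * n.+1%:R * (n%:R ^+ 2) ^+ k.+1 < n%:R).
Proof.
move=> n0; have nR0 : (0 : R) < n%:R by rewrite ltr0n.
have n10 : (0 : R) < n.+1%:R by rewrite ltr0n.
have N0 : (0 : R) < n%:R ^+ 2 by rewrite exprn_gt0.
elim: k x y => [|k IH] x y Ex Ey;
  have [a [x' [Ex' ->]]] := dust_unfold _ _ _ _ n0 Ex;
  have [b [y' [Ey' ->]]] := dust_unfold _ _ _ _ n0 Ey;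
  have [<-|ab] := eqVneq a b.
- rewrite enorm_dust_map => /andP[+ _]; apply/negP; rewrite -leNgt.
  have -> : (n%:R ^+ 2)^-1 * enorm (x' - y') * n.+1%:R * (n%:R ^+ 2) ^+ 1 =
      enorm (x' - y') * n.+1%:R by rewrite expr1; field; rewrite lt0r_neq0.
  by rewrite -ler_pdivlMr//; exact: dust_enorm_le.
- have := dust_separation _ _ _ _ _ _ _ ab Ex' Ey'.
  rewrite expr1 => h /andP[_]; apply/negP; rewrite -leNgt.
  by rewrite -ler_pdivrMr// -ler_pdivrMr// mulrAC.
- rewrite enorm_dust_map [_ ^+ k.+2]exprS => h; apply: (IH _ _ Ex' Ey').
  move: h; rewrite (_ : _ * (_ * _) = enorm (x' - y') * n.+1%:R * (n%:R ^+ 2) ^+ k.+1)//.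
  by move: (_ ^+ k.+1) => w; field; rewrite lt0r_neq0.
- have := dust_separation _ _ _ _ _ _ _ ab Ex' Ey'.
  move=> h /andP[_]; apply/negP; rewrite -leNgt exprS mulrA.
  apply: (@le_trans _ _ (enorm (dust_map R d n a x' - dust_map R d n b y') * n.+1%:R *
    n%:R ^+ 2)); first by rewrite -ler_pdivrMr// -ler_pdivrMr// mulrAC.
  rewrite ler_peMr ?exprn_ege1 ?ler1n//.
  by rewrite !mulr_ge0 ?enorm_ge0.
Qed.

Lemma dust_missing_distances (R : realType) (d n : nat) (a : R) :
  (1 < n)%N -> (d < n)%N ->
  0 < a -> ~ (`[0, a[ `<=` distance_set (cantor_dust R d n)).
Proof.
move=> n1 dn a0 sub; have n0 := ltnW n1.
have [N0 zP] := inv_sqr_itv R n n1.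
pose w : R := d%:R + 2^-1.
have w0 : 0 < w by rewrite ltr_wpDl.
(* The value w lies strictly between d and n, hence inside the rescaled gap. *)
have [k kP] := geometric_small R (w / n.+1%:R / n%:R ^+ 2) _ a zP a0.
have [|x Ex [y Ey xy]] := sub (w / n.+1%:R / n%:R ^+ 2 * (n%:R ^+ 2)^-1 ^+ k).
  rewrite /= in_itv/= kP andbT; apply: mulr_ge0.
    by rewrite !divr_ge0 ?ltW.
  by rewrite exprn_ge0// invr_ge0 ltW.
apply: (dust_gap R d n k _ _ n0 Ex Ey); rewrite xy.
have -> : w / n.+1%:R / n%:R ^+ 2 * (n%:R ^+ 2)^-1 ^+ k * n.+1%:R *
    (n%:R ^+ 2) ^+ k.+1 = w.
  rewrite exprVn [_ ^+ k.+1]exprS -[n.+1%:R]natr1.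
  have : (n%:R ^+ 2) ^+ k != 0 :> R by rewrite expf_neq0 ?lt0r_neq0.
  move: (_ ^+ k) => v v0; field.
  by rewrite v0 natr1 !pnatr_eq0 -lt0n n0.
have : d.+1%:R <= n%:R :> R by rewrite ler_nat.
by rewrite -natr1 /w => dn1; apply/andP; split; lra.
Qed.

(** Near x there is another point that differs from x in one coordinate only. *)
Lemma dust_perfect (R : realType) (d n : nat) : (0 < d)%N -> (1 < n)%N ->
  perfect_set (cantor_dust R d n).
Proof.
move=> d0 n1; have n0 := ltnW n1.
have cE : closed (cantor_dust R d n).
  apply: compact_closed; first exact: norm_hausdorff.
  by have [] := dust_self_similar R d n n1.
split => //; apply/seteqP; split => [x /subset_limit_point|x Ex].
  exact: cE.
have [N0 zP] := inv_sqr_itv R n n1.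
move=> U /nbhs_ballP[e /= e0 eU].
have [k kP] := geometric_small R 1 _ e zP e0.
pose i0 := Ordinal d0.
have [c [Cc cx xc]] := digit_cantor_dense_in_itself R n k (x 0 i0) n0 (Ex i0).
pose y : 'rV[R]_d := \row_i (if i == i0 then c else x 0 i).
exists y; split.
- by apply: contra cx => /eqP <-; rewrite mxE eqxx.
- by move=> i; rewrite mxE; case: eqP.
- apply: eU; split=> // j i; rewrite mxE ord1.
  case: eqP => [->|_]; last exact: ballxx.
  by rewrite /ball/=; apply: le_lt_trans xc _; rewrite -exprVn -[ltLHS]mul1r.
Qed.

Lemma dust_cantor_set (R : realType) (d n : nat) :
  (0 < d)%N -> (d < n)%N -> cantor_set (cantor_dust R d n).
Proof.
move=> d0 dn; have n1 : (1 < n)%N by exact: leq_ltn_trans dn.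
have [E0 cE _] := dust_self_similar R d n n1; split => //.
  exact: dust_perfect.
apply: totally_disconnected_of_missing_distances => a.
exact: dust_missing_distances.
Qed.

(** The top corner of the first set lies in the second one, whose coordinates
    are at most 1/(m+1). *)
Lemma cantor_dust_eq_le (R : realType) (d n m : nat) : (0 < d)%N -> (0 < n)%N ->
  cantor_dust R d n = cantor_dust R d m -> (m <= n)%N.
Proof.
move=> d0 n0 nm.
have : cantor_dust R d n (const_mx n.+1%:R^-1).
  by move=> i; rewrite mxE; exact: digit_cantor_max.
rewrite nm => /(_ (Ordinal d0)); rewrite mxE => /digit_cantor_bounds /andP[_].
by rewrite lef_pV2 ?posrE ?ltr0n// ler_nat.
Qed.

(** On the first coordinate axis the two dilates contain 2 n C and 2 C, and the
    factor 2 stretches the interval [0, n/(n+1)) to cover [0, 1). *)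
Lemma dust_union_distances (R : realType) (d n : nat) : (0 < d)%N -> (1 < n)%N ->
  exists K, finite_union_affine_copies (cantor_dust R d n) K /\
    `[0, 1[ `<=` distance_set K.
Proof.
move=> d0 n1; have n0 := ltnW n1; set E := cantor_dust R d n.
have nR0 : (0 : R) < n%:R by rewrite ltr0n.
pose u (i : 'I_2) : R := if i == 0 then 2 * n%:R else 2.
exists (\bigcup_i affine_copy (0 : 'rV[R]_d) (u i) E); split.
  exists 2%N, (fun=> 0), u; split => // i; rewrite /u.
  by case: ifP => _; rewrite ?mulr_gt0.
move=> t /=; rewrite in_itv/= => /andP[t0 t1].
have [|c [c' [Cc Cc' tE]]] := digit_cantor_dilate_diff R n (t / 2) n1.
  rewrite divr_ge0//=; apply: (@lt_le_trans _ _ 2^-1); first lra.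
  rewrite ler_pdivlMr// mulrC ler_pdivrMr// mulr_natr -mulrnA ler_nat; lia.
pose p c : 'rV[R]_d := c *: delta_mx 0 (Ordinal d0).
have pE b : digit_cantor R n b -> E (p b).
  move=> Cb i; rewrite !mxE eqxx /=; case: eqP => _; first by rewrite mulr1.
  by rewrite mulr0; exact: digit_cantor0.
exists (0 + u 0 *: p c); first by exists 0 => //; exists (p c) => //; exact: pE.
exists (0 + u 1 *: p c'); first by exists 1 => //; exists (p c') => //; exact: pE.
rewrite !add0r /u /= /p !scalerA -scalerBl enorm_delta.
suff -> : 2 * n%:R * c - 2 * c' = t by rewrite ger0_norm.
by rewrite -mulrA -mulrBr -tE; field.
Qed.

(** * Hausdorff measure and dimension *)

Lemma diam_pow_ge0 (R : realType) (d : nat) (s : R) (U : set 'rV[R]_d) :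
  (0 <= diam_pow s U)%E.
Proof. by rewrite /diam_pow; case: ifP => // _; exact: poweR_ge0. Qed.

Lemma diam_pow_le (R : realType) (d : nat) (s r : R) (U : set 'rV[R]_d) :
  0 <= s -> 0 <= r -> (diam U <= r%:E)%E -> (diam_pow s U <= (r `^ s)%:E)%E.
Proof.
move=> s0 r0 Ur; rewrite /diam_pow; case: ifPn => [_|/set0P[x Ux]].
  by rewrite lee_fin powR_ge0.
have U0 : (0 <= diam U)%E.
  apply: ereal_sup_ubound; exists x => //; exists x => //.
  by rewrite subrr enorm0.
rewrite -poweR_EFin gt0_ler_poweR// in_itv/= ?U0 ?leey//.
by rewrite lee_fin r0.
Qed.

Lemma premeasure_finite_cover (R : realType) (d : nat) (s r delta : R)
    (E : set 'rV[R]_d) (l : seq (set 'rV[R]_d)) :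
  0 <= s -> 0 <= r <= delta ->
  (forall x, E x -> exists2 U, U \in l & U x) ->
  (forall U, U \in l -> (diam U <= r%:E)%E) ->
  (hausdorff_premeasure s delta E <= ((size l)%:R * r `^ s)%:E)%E.
Proof.
move=> s0 /andP[r0 rd] El lr.
have d0 : diam (set0 : set 'rV[R]_d) = -oo%E.
  rewrite /diam (_ : [set _ | _ in _ & _ in _] = set0) ?ereal_sup0//.
  by apply/seteqP; split => // t [x].
have lri i : (diam (nth set0 l i) <= r%:E)%E.
  have [il|il] := ltnP i (size l); first by apply: lr; exact: mem_nth.
  by rewrite nth_default// d0 leNye.
(* The empty set pads the finite cover to a sequence and contributes 0. *)
apply: (@le_trans _ _ (\sum_(0 <= i <oo) diam_pow s (nth set0 l i))%E).
  apply: ereal_inf_lbound; exists (nth set0 l) => //; split.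
    move=> x /El[U Ul Ux]; exists (index U l) => //.
    by rewrite nth_index.
  by move=> i; apply: (le_trans (lri i)); rewrite lee_fin.
rewrite (nneseries_split 0 (size l)); last by move=> k _; exact: diam_pow_ge0.
rewrite add0n [X in (_ + X)%E]eseries0 ?adde0; last first.
  by move=> i il _; rewrite nth_default// /diam_pow eqxx.
apply: (@le_trans _ _ (\sum_(0 <= i < size l) (r `^ s)%:E)%E).
  by apply: lee_sum => i _; exact: diam_pow_le.
by rewrite sumEFin sumr_const_nat subn0 mulr_natl.
Qed.

Lemma hausdorff_measure_eq0 (R : realType) (d : nat) (s : R) (E : set 'rV[R]_d) :
  (forall delta e : R, 0 < delta -> 0 < e ->
     (hausdorff_premeasure s delta E <= e%:E)%E) ->
  hausdorff_measure s E = 0%E.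
Proof.
move=> small; apply/eqP; rewrite eq_le; apply/andP; split.
  apply: ge_ereal_sup => _ [delta /= delta0 <-].
  by apply/lee_addgt0Pr => e e0; rewrite add0e; exact: small.
apply: (@le_trans _ _ (hausdorff_premeasure s 1 E)); last first.
  by apply: ereal_sup_ubound; exists 1 => //=.
apply: le_ereal_inf_tmp => _ [U _ <-]; apply: nneseries_ge0 => i _ _.
exact: diam_pow_ge0.
Qed.

Lemma dust_cover (R : realType) (d n k : nat) : (0 < n)%N -> (d < n)%N ->
  exists l : seq (set 'rV[R]_d),
    [/\ size l = ((n ^ d) ^ k)%N,
        forall x, cantor_dust R d n x -> exists2 U, U \in l & U x &
        forall U x y, U \in l -> U x -> U y -> enorm (x - y) <= (n%:R ^+ 2) ^- k].
Proof.
move=> n0 dn; have N0 : (0 : R) < n%:R ^+ 2 by rewrite exprn_gt0 // ltr0n.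
elim: k => [|k [l [ls lE lU]]].
  exists [:: cantor_dust R d n]; split => //.
    by move=> x Ex; exists (cantor_dust R d n); rewrite ?mem_seq1.
  move=> U x y; rewrite mem_seq1 => /eqP -> Ex Ey; rewrite expr0 invr1.
  apply: (le_trans (dust_enorm_le _ _ _ _ _ Ex Ey)).
  by rewrite ler_pdivrMr// mul1r ler_nat ltnW// ltnW.
exists [seq dust_map R d n a @` U | a <- enum {ffun 'I_d -> 'I_n}, U <- l]; split.
- by rewrite size_allpairs ls -cardE card_ffun !card_ord expnS.
- move=> x /(dust_unfold _ _ _ _ n0)[a [y [Ey ->]]].
  have [U Ul Uy] := lE _ Ey; exists (dust_map R d n a @` U); last by exists y.
  by apply: allpairs_f => //; rewrite mem_enum.
- move=> _ _ _ /allpairsP[[a U] /= [_ Ul ->]] [x Ux <-] [y Uy <-].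
  rewrite enorm_dust_map [_ ^+ k.+1]exprS [(_ * _ ^+ k)^-1]invfM.
  by rewrite ler_pM2l ?invr_gt0//; exact: lU Ul Ux Uy.
Qed.

(** The k-th generation consists of n^dk cells of diameter at most n^-2k, so its
    contribution is the k-th power of n^(d - 2s) < 1. *)
Lemma dust_hausdorff_measure0 (R : realType) (d n : nat) (s : R) :
  (1 < n)%N -> (d < n)%N -> d%:R < 2 * s ->
  hausdorff_measure s (cantor_dust R d n) = 0%E.
Proof.
move=> n1 dn ds; have n0 := ltnW n1.
have nR1 : (1 : R) < n%:R by rewrite ltr1n.
have nR0 : (0 : R) < n%:R by rewrite ltr0n.
have [N0 zP] := inv_sqr_itv R n n1.
have s0 : 0 <= s by rewrite -(pmulr_rge0 _ (ltr0n R 2)) (le_trans (ler0n R d))// ltW.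
pose z : R := (n ^ d)%:R * (n%:R ^+ 2)^-1 `^ s.
have z0 : 0 <= z by rewrite mulr_ge0 ?powR_ge0.
have z1 : z < 1.
  have -> : z = n%:R `^ (d%:R - 2 * s).
    rewrite powRD; last by rewrite lt0r_neq0 ?implybT.
    rewrite powR_mulrn ?ltW// -natrX; congr (_ * _).
    by rewrite -mulrN mulrN -mulNr powRrM powR_invn ?ltW.
  rewrite /powR (negbTE (lt0r_neq0 nR0)) expR_lt1 nmulr_rlt0 ?ln_gt0//.
  by rewrite subr_lt0.
apply: hausdorff_measure_eq0 => delta e delta0 e0.
have zb : 0 <= z < 1 by rewrite z0.
have [k1 k1P] := geometric_small R 1 _ delta zP delta0.
have [k2 k2P] := geometric_small R 1 _ e zb e0.
pose k := maxn k1 k2.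
have [l [ls lE lU]] := dust_cover R d n k n0 dn.
have rb : 0 <= (n%:R ^+ 2 : R) ^- k <= delta.
  apply/andP; split; first by rewrite invr_ge0 exprn_ge0.
  rewrite -exprVn; apply: le_trans (ltW k1P); rewrite mul1r.
  have /andP[? ?] := zP.
  by rewrite ler_wiXn2l ?leq_maxl// ltW.
apply: (le_trans (premeasure_finite_cover _ _ s _ _ _ l s0 rb lE _)).
  move=> U Ul; apply: ge_ereal_sup => _ [x Ux [y Uy <-]].
  by rewrite lee_fin; exact: lU Ul Ux Uy.
rewrite lee_fin ls natrX -exprVn -[_^-1 ^+ k]powR_mulrn; last by rewrite invr_ge0 ltW.
rewrite powRAC powR_mulrn ?powR_ge0// -exprMn -/z.
apply: le_trans (ltW k2P); rewrite mul1r.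
by rewrite ler_wiXn2l ?leq_maxr// ltW.
Qed.

(** * The collection of Cantor sets *)

Theorem corollary1p3 (R : realType) (d : nat) (rho a_rho b_rho eps_rho : R)
    (hd : (2 <= d)%N) (hrho : 0 < rho < 1)
    (ha : 0 < a_rho) (hab : a_rho < b_rho) (hb : b_rho < 1)
    (heps : 0 < eps_rho < 1)
    (hP : property_P d rho a_rho b_rho eps_rho)
    (s : R) (hs : d%:R - eps_rho < s <= d%:R) :
  exists EE : set (set 'rV[R]_d),
    infinite_set EE /\
    forall E : set 'rV[R]_d, EE E ->
      [/\ [/\ self_similar E, cantor_set E & E `<=` unit_cube R d],
          (hausdorff_dim E <= s%:E)%E,
          forall a : R, 0 < a -> ~ (`[0, a[ `<=` distance_set E) &
          exists K : set 'rV[R]_d,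
            finite_union_affine_copies E K /\
            `[0, b_rho] `<=` distance_set K].
Proof.
have d0 : (0 < d)%N by exact: ltnW.
exists (range (fun j => cantor_dust R d (d.+1 + j))); split.
  apply/infiniteP; rewrite (card_le_eqr (inj_card_eq _))//.
  move=> i j _ _ /= ij; apply/eqP; rewrite -(eqn_add2l d.+1) eqn_leq.
  by rewrite (cantor_dust_eq_le _ _ _ _ d0 _ ij)// (cantor_dust_eq_le _ _ _ _ d0 _ (esym ij)).
move=> _ [j _ <-]; set n := (d.+1 + j)%N.
have dn : (d < n)%N by rewrite leq_addr.
have n1 : (1 < n)%N by exact: leq_ltn_trans dn.
split.
- split; [exact: dust_self_similar|exact: dust_cantor_set|move=> x Ex i].
  have /andP[-> x1] := digit_cantor_bounds _ _ _ (Ex i).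
  by apply: (le_trans x1); rewrite invf_le1 ?ler1n ?ltr0n.
- have d2 : 2 <= d%:R :> R by rewrite ler_nat.
  have /andP[e0 e1] := heps; have /andP[s1 _] := hs.
  apply: ereal_inf_lbound; exists s => //=; split; first lra.
  by apply: dust_hausdorff_measure0 => //; lra.
- by move=> a; exact: dust_missing_distances.
- have [K [KE K1]] := dust_union_distances R d n d0 n1.
  exists K; split => // t /=; rewrite in_itv/= => /andP[t0 tb].
  by apply: K1; rewrite /= in_itv/= t0 (le_lt_trans tb).
Qed.
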